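(* Let $p$ be a prime and $0<b<1$. Let $\{Y_n^k\}_{k\in\mathbb{N}_0,\,0\leq n\leq p^{k+1}-1}$ be a family of independent and identically distributed real random variables having any non-degenerate distribution such that $\mathbb{E}(|Y_0^0-Y_0^1|^q)<\infty$ for some $q>0$. Extend it periodically to $\{Y_n^k\}_{k,n\in\mathbb{N}_0}$ by setting $Y_\ell^k=Y_n^k$ whenever $\ell\equiv n\pmod{p^{k+1}}$, and define $$X_n=\sum_{k=0}^\infty b^k(Y_n^k-Y_0^k),\quad n\in\mathbb{N}_0$$ (a series which converges almost surely). Then $\{X_n\}_{n\in\mathbb{N}_0}$ is dt-ss-si with scaling function $b(n)=(|n|_p)^H$, where $H=-\log_p(b)$.
   Context: $\mathbb{N}=\{1,2,\dots\}$, $\mathbb{N}_0=\{0,1,2,\dots\}$; $\overset{d}{=}$ denotes equality in distribution. In $Y_n^k$ the superscript $k$ is an index, while $b^k$ is the $k$-th power of the number $b$; the scaling function $b(\cdot)$ is distinct from the number $b$. $|n|_p=p^{-v_p(n)}$ is the $p$-adic norm. A real-valued process $\{X_m\}_{m\in\mathbb{N}_0}$ is dt-ss-si with scaling function $b(\cdot):\mathbb N\to(0,\infty)$ if $\{X_{nm}\}_{m\in\mathbb{N}_0}\overset{d}{=}\{b(n)X_m\}_{m\in\mathbb{N}_0}$ for every $n\in\mathbb{N}$, and $\{X_{m+1}-X_m\}_{m\in\mathbb{N}_0}\overset{d}{=}\{X_{m+k+1}-X_{m+k}\}_{m\in\mathbb{N}_0}$ for every $k\in\mathbb{N}$. *)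

(* Defs.v *)
From mathcomp Require Import all_boot all_order all_algebra finmap.
From mathcomp Require Import all_classical all_reals all_analysis.

Set Implicit Arguments.
Unset Strict Implicit.
Unset Printing Implicit Defensive.

Import Order.TTheory GRing.Theory Num.Theory.
Import numFieldNormedType.Exports.
Local Open Scope classical_set_scope.
Local Open Scope ring_scope.

Section Probability.
Context {d : measure_display} {T : measurableType d} {R : realType}.
Variable P : probability T R.

(* Only the indices in D matter; X is arbitrary outside D. *)
Definition mutually_independent (I : choiceType) (D : set I)
    (X : I -> {RV P >-> R}) : Prop :=
  forall J : {fset I}, [set` J] `<=` D ->
  forall A : I -> set R, (forall i, measurable (A i)) ->
    P (\bigcap_(i in [set` J]) (X i @^-1` A i)) =
    (\prod_(i <- J) P (X i @^-1` A i))%E.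

Definition identically_distributed (I : Type) (D : set I)
    (X : I -> {RV P >-> R}) : Prop :=
  forall i j, D i -> D j -> forall A : set R, measurable A ->
    distribution P (X i) A = distribution P (X j) A.

Definition nondegenerate_rv (X : {RV P >-> R}) : Prop :=
  ~ exists c : R, {ae P, forall t, X t = c}.

Definition coordinate_cylinders : set (set (nat -> R)) :=
  [set C | exists m (B : set R), measurable B /\ C = [set x | B (x m)]].

(* Equality in distribution of the random sequences X and X', i.e. of their
   laws on R^nat with the product sigma-algebra. *)
Definition eq_in_dist (X X' : nat -> T -> R) : Prop :=
  forall A : set (nat -> R), <<s coordinate_cylinders >> A ->
    P [set t | A (X ^~ t)] = P [set t | A (X' ^~ t)].

(* beta is only constrained, and only used, at positive integers. *)
Definition dt_ss_si (X : nat -> T -> R) (beta : nat -> R) : Prop :=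
  [/\ forall m, measurable_fun [set: T] (X m),
      forall n, (0 < n)%N -> 0 < beta n,
      forall n, (0 < n)%N ->
        eq_in_dist (fun m => X (n * m)%N) (fun m t => beta n * X m t)
    & forall k, (0 < k)%N ->
        eq_in_dist (fun m t => X m.+1 t - X m t)
                   (fun m t => X (m + k).+1 t - X (m + k)%N t)].

(* Y k n stands for Y_n^k. *)
Definition block_index (p : nat) : set (nat * nat) :=
  [set kn | (kn.2 < p ^ kn.1.+1)%N].

Definition periodic_extension (p : nat) (Y : nat -> nat -> {RV P >-> R}) :
    nat -> nat -> {RV P >-> R} :=
  fun k n => Y k (n %% p ^ k.+1)%N.

Definition partial_sums (p : nat) (b : R) (Y : nat -> nat -> {RV P >-> R})
    (n : nat) (t : T) : R^nat :=
  series (fun k => b ^+ k *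
    (periodic_extension p Y k n t - periodic_extension p Y k 0 t)).

(* Where the series diverges, limn takes a fixed default value. *)
Definition periodic_sum (p : nat) (b : R) (Y : nat -> nat -> {RV P >-> R})
    (n : nat) (t : T) : R :=
  limn (partial_sums p b Y n t).

End Probability.

(* Meant for n > 0: at n = 0 this gives 1 instead of 0. *)
Definition padic_norm (R : realType) (p n : nat) : R := p%:R ^- logn p n.

(* Main.v *)
Require Import Defs.
From mathcomp Require Import all_boot all_order all_algebra finmap.
From mathcomp Require Import all_classical all_reals all_analysis.
From mathcomp Require Import measurable_realfun.

Set Implicit Arguments.
Unset Strict Implicit.
Unset Printing Implicit Defensive.

Import Order.TTheory GRing.Theory Num.Theory.
Import numFieldNormedType.Exports.
Local Open Scope classical_set_scope.
Local Open Scope ring_scope.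

(** The sequence X is one fixed functional of the i.i.d. block family: X n is
    block_sum n applied to the array y (k, i) = Y k i with i < p ^ (k + 1).
    Applying an injection of the index set of the array to itself leaves the
    law of an i.i.d. array unchanged, so both invariances of X reduce to
    finding an injection of block indices which produces the transformed
    sequence, almost surely.

    For the increments the injection is the rotation of every block by l: in
    each term of the series the constant Y k 0 turns into Y k l, so the rotated
    array has block sums X (m + l) - X l, whose increments are those of X
    shifted by l.

    For the self-similarity write n = u p ^ v with u prime to p.  The terms
    k < v of X (n m) vanish because p ^ (k + 1) divides n m.  The term of index
    v + j only sees the index p ^ v (u m mod p ^ (j + 1)) of block v + j.  Thus
    X (n m) is b ^ v times the m-th block sum of the array read through
    (j, i) |-> (v + j, p ^ v (u i mod p ^ (j + 1))), an injection since u is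
    invertible modulo p ^ (j + 1).  Finally b ^ v is the value at n of the
    scaling function.

    Subtracting two series requires that they converge.  With r = sqrt b,
    Markov's inequality for the q-th moment bounds the probability that
    |Y k i - Y k 0| >= r ^ (- k) by a constant times (r ^ q) ^ k; these bounds
    are summable, so by Borel-Cantelli r ^ k |Y k i - Y k 0| is almost surely
    bounded in k, and the series is dominated by a geometric one of ratio r.

    The equality of laws of i.i.d. arrays is eq_law_reindex, a consequence of
    the pi-lambda theorem (eq_law_independent).  To transport it to X one needs
    block_sum to be measurable everywhere, also where the series diverges
    (measurable_limn). *)

(** * Measurability of limits of real sequences *)

Section MeasurableLimit.
Context {d : measure_display} {T : measurableType d} {R : realType}.

(** Upper and lower limits in the extended reals are measurable without any
    convergence assumption, so this criterion makes the set of convergence of a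
    sequence of measurable functions measurable. *)
Lemma cvgn_limn_esup (u : R^nat) :
  cvgn u <-> (limn_einf (EFin \o u) == limn_esup (EFin \o u)) &&
             (limn_esup (EFin \o u) \is a fin_num).
Proof.
split.
  move=> /cvg_ex[l ul].
  have /cvg_limn_einf_sup[-> ->] : (EFin \o u) @ \oo --> l%:E.
    by apply: cvg_EFin => //; exact: nearW.
  by rewrite eqxx.
move=> /andP[/eqP uE ufin].
have /fine_cvgP[_ ul] : (EFin \o u) @ \oo --> (fine (limn_esup (EFin \o u)))%:E.
  apply: (@squeeze_cvge _ _ _ _ (einfs (EFin \o u)) _ (esups (EFin \o u))).
  - apply: nearW => n; apply/andP; split.
      by apply: ereal_inf_lbound; exists n => /=.
    by apply: ereal_sup_ubound; exists n => /=.
  - by rewrite fineK// -uE limn_einf_lim; exact: is_cvg_einfs.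
  - by rewrite fineK// limn_esup_lim; exact: is_cvg_esups.
by apply/cvg_ex; exists (fine (limn_esup (EFin \o u))).
Qed.

(** Off the measurable set of convergence, [limn] is the constant [point]; on
    it, [limn] is the upper limit. *)
Lemma measurable_limn (u : nat -> T -> R) :
  (forall n, measurable_fun [set: T] (u n)) ->
  measurable_fun [set: T] (fun t => limn (u ^~ t)).
Proof.
move=> mu; pose U t : (\bar R)^nat := EFin \o u ^~ t.
pose S t : \bar R := limn_esup (U t).
pose I t : \bar R := limn_einf (U t).
have mS : measurable_fun [set: T] S.
  apply: (@measurable_fun_limn_esup _ _ _ _ (fun n t => (u n t)%:E)) => n.
  exact/measurable_EFinP.
have mI : measurable_fun [set: T] I.
  rewrite /I /limn_einf; apply: measurableT_comp => //.
  apply: (@measurable_fun_limn_esup _ _ _ _ (fun n t => - (u n t)%:E)%E) => n.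
  by apply: measurableT_comp => //; exact/measurable_EFinP.
pose C t := (I t == S t) && (S t \is a fin_num).
have -> : (fun t => limn (u ^~ t)) =
    (fun t => if C t then fine (S t) else point).
  apply/funext => t; case: ifPn => Ct.
    have /cvgn_limn_esup ut := Ct.
    have : U t @ \oo --> (limn (u ^~ t))%:E.
      by apply: cvg_EFin => //; exact: nearW.
    by rewrite /S => /cvg_limn_einf_sup[_ ->].
  by apply: dvgP => /cvgn_limn_esup; apply/negP.
apply: measurable_fun_ifT => //; last first.
  by apply: measurableT_comp.
apply: measurable_and; last first.
  by apply: (measurable_fun_bool true); exact: emeasurable_fin_num.
exact: measurable_fun_eqe.
Qed.
End MeasurableLimit.

(** * Laws of independent families *)

(** Only the coordinates in [D] generate: families that are independent over [D]
    can be compared on this sigma-algebra, but not on the one generated by all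
    coordinates. *)
Definition coord_cylinders (R : realType) (I : Type) (D : set I) :
    set (set (I -> R)) :=
  [set C | exists2 i, D i &
    exists2 B : set R, measurable B & C = [set x | B (x i)]].

Section IndependentFamilies.
Context {d : measure_display} {T : measurableType d} {R : realType}.
Variable P : probability T R.

(** The pi-lambda theorem: finite boxes form a pi-system generating the cylinder
    sigma-algebra, independence computes their probabilities from the marginal
    laws, and the sets on which the two laws agree form a Dynkin system. *)
Lemma eq_law_independent (I : choiceType) (D : set I)
    (Z Z' : I -> {RV P >-> R}) :
  mutually_independent D Z -> mutually_independent D Z' ->
  (forall i, D i -> forall A, measurable A ->
    P (Z i @^-1` A) = P (Z' i @^-1` A)) ->
  forall A, <<s coord_cylinders D >> A ->
    P [set t | A (Z ^~ t)] = P [set t | A (Z' ^~ t)].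
Proof.
move=> indZ indZ' ZZ'.
pose box (J : {fset I}) (B : I -> set R) : set (I -> R) :=
  [set x | forall i, i \in J -> B i (x i)].
pose boxes := [set C | exists J B, [/\ [set` J] `<=` D,
  forall i, measurable (B i) & C = box J B]].
have boxesI : setI_closed boxes.
  move=> _ _ [J1 [B1 [J1D mB1 ->]]] [J2 [B2 [J2D mB2 ->]]].
  exists (J1 `|` J2)%fset.
  (* A coordinate constrained by only one of the boxes keeps that constraint. *)
  exists (fun i => (if i \in J1 then B1 i else setT) `&`
                   (if i \in J2 then B2 i else setT)); split.
  - by move=> i /=; rewrite inE => /orP[/J1D|/J2D].
  - by move=> i; apply: measurableI; case: ifP.
  - apply/seteqP; split => x /=.
      by move=> [x1 x2] i _; split; case: ifPn => // iJ; [exact: x1|exact: x2].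
    move=> x12; split => i iJ.
      by have [+ _] := x12 i (fsubsetP (fsubsetUl _ _) _ iJ); rewrite iJ.
    by have [_ +] := x12 i (fsubsetP (fsubsetUr _ _) _ iJ); rewrite iJ.
have cyl_boxes : coord_cylinders D `<=` boxes.
  move=> _ [i Di [B mB ->]]; exists [fset i]%fset, (fun=> B); split => //.
    by move=> j /=; rewrite inE => /eqP ->.
  apply/seteqP; split => x /=; first by move=> Bx j; rewrite inE => /eqP ->.
  by apply; rewrite inE.
have box_preim (W : I -> {RV P >-> R}) J B :
    [set t | box J B (W ^~ t)] = \bigcap_(i in [set` J]) (W i @^-1` B i).
  by apply/seteqP; split.
have mbox (W : I -> {RV P >-> R}) J B : (forall i, measurable (B i)) ->
    measurable [set t | box J B (W ^~ t)].
  move=> mB; rewrite box_preim; apply: fin_bigcap_measurable => //.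
  by move=> i _; rewrite -[X in measurable X]setTI; exact: measurable_funP.
pose E := [set A : set (I -> R) | [/\ measurable [set t | A (Z ^~ t)],
  measurable [set t | A (Z' ^~ t)] &
  P [set t | A (Z ^~ t)] = P [set t | A (Z' ^~ t)]]].
have dynE : dynkin E.
  split.
  - by split => //; exact: measurableT.
  - move=> A [m1 m2 PE]; split; [exact: measurableC|exact: measurableC|].
    have := probability_setC P m1; have := probability_setC P m2.
    by rewrite PE => <- <-.
  - move=> F tF EF.
    have pre (W : I -> {RV P >-> R}) : [set t | (\bigcup_k F k) (W ^~ t)] =
        \bigcup_k [set t | F k (W ^~ t)] by [].
    have tr (W : I -> {RV P >-> R}) :
        trivIset setT (fun k => [set t | F k (W ^~ t)]).
      move=> i j _ _ [t [Fi Fj]].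
      by apply: (tF i j) => //; exists (W ^~ t).
    rewrite /E /= !pre; split.
    + by apply: bigcupT_measurable => k; have [] := EF k.
    + by apply: bigcupT_measurable => k; have [] := EF k.
    + rewrite !measure_bigcup//=;
        [|by move=> k _; case: (EF k)|by move=> k _; case: (EF k)].
      by apply: eq_eseriesr => k _; have [] := EF k.
move=> A /(sub_sigma_algebra2 cyl_boxes).
rewrite -setI_closed_g_dynkin_g_sigma_algebra//.
suff /[apply] -[] : <<d boxes >> `<=` E by [].
apply: smallest_sub => // _ [J [B [JD mB ->]]].
split; [exact: mbox|exact: mbox|].
rewrite !box_preim indZ// indZ'//.
by apply: eq_big_seq => i iJ; apply: ZZ' => //; exact: JD.
Qed.

Lemma mutually_independent_inj (I I' : pointedType) (D : set I) (D' : set I')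
    (Y : I -> {RV P >-> R}) (phi : I' -> I) :
  mutually_independent D Y -> set_inj D' phi -> (forall i, D' i -> D (phi i)) ->
  mutually_independent D' (Y \o phi).
Proof.
move=> indY phi_inj phiD J JD A mA.
(* The constraint on the coordinate [j] of [Y] is the one attached to the unique
   [i] in [J] with [phi i = j]. *)
pose A' j := A (xget point [set i | i \in J /\ phi i = j]).
have A'E i : i \in J -> A' (phi i) = A i.
  move=> iJ; rewrite /A'; case: xgetP => [k _ [kJ pk]|/(_ i)/=]; last by case.
  by congr A; apply: phi_inj => //; apply/mem_set; exact: JD.
have := indY (phi @` J)%fset _ A' (fun j => mA _).
rewrite big_imfset/=; last first.
  by move=> i j iJ jJ; apply: phi_inj; apply/mem_set; exact: JD.
rewrite (eq_big_seq (fun i => P ((Y \o phi) i @^-1` A i))); last first.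
  by move=> i iJ /=; rewrite A'E.
move=> <-.
  congr (P _); apply/seteqP; split => t tA.
    by move=> _ /= /imfsetP[i /= iJ ->]; rewrite A'E//; exact: tA.
  move=> i /= iJ; rewrite -A'E//; apply: tA => /=.
  by apply/imfsetP; exists i.
by move=> _ /= /imfsetP[i /= iJ ->]; apply: phiD; exact: JD.
Qed.

End IndependentFamilies.

(** * Equality in distribution of random sequences *)

Section RandomSequences.
Context {d : measure_display} {T : measurableType d} {R : realType}.

Lemma measurable_coord (I : pointedType) (D : set I) (i : I) : D i ->
  measurable_fun [set: g_sigma_algebraType (@coord_cylinders R I D)]
    (fun x : I -> R => x i).
Proof.
move=> Di _ B mB; rewrite setTI; apply: sub_sigma_algebra.
by exists i => //; exists B.
Qed.

Lemma measurable_sequence_preimage (X : nat -> T -> R) :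
  (forall m, measurable_fun [set: T] (X m)) ->
  forall A, <<s @coordinate_cylinders R >> A -> measurable [set t | A (X ^~ t)].
Proof.
move=> mX; apply: smallest_sub.
  split => /=.
  - exact: measurable0.
  - move=> A mA; rewrite [X in measurable X](_ : _ = ~` [set t | A (X ^~ t)]).
      exact: measurableC.
    by apply/seteqP; split => t //= [].
  - by move=> F mF; exact: bigcupT_measurable.
move=> _ [m [B [mB ->]]] /=.
by rewrite -[X in measurable X]setTI; exact: mX.
Qed.

End RandomSequences.

Section EqualLaws.
Context {d : measure_display} {T : measurableType d} {R : realType}.
Variable P : probability T R.

Lemma eq_in_dist_ae (X X' : nat -> T -> R) :
  (forall m, measurable_fun [set: T] (X m)) ->
  (forall m, measurable_fun [set: T] (X' m)) ->
  (forall m, {ae P, forall t, X m t = X' m t}) -> eq_in_dist P X X'.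
Proof.
move=> mX mX' /ae_foralln XX' A sA.
have mA := measurable_sequence_preimage mX sA.
have mA' := measurable_sequence_preimage mX' sA.
have [N [mN N0 XN]] := XX'.
have eqN t : ~ N t -> X ^~ t = X' ^~ t.
  move=> Nt; apply/funext => m; apply: contra_notP Nt => Xt.
  by apply: XN => /(_ m).
have PN B : measurable B -> P B = P (B `\` N).
  move=> mB; rewrite measureD//; last by rewrite ltey_eq fin_num_measure.
  rewrite (subset_measure0 _ _ (@subIsetr _ B N)) ?sube0//.
  exact: measurableI.
rewrite (PN _ mA) (PN _ mA'); congr (P _).
apply/seteqP; split => t /= [At Nt]; split => //;
  by move: At; rewrite (eqN t Nt).
Qed.

Lemma eq_in_dist_trans (X X' X'' : nat -> T -> R) :
  eq_in_dist P X X' -> eq_in_dist P X' X'' -> eq_in_dist P X X''.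
Proof. by move=> XX' X'X'' A sA; rewrite XX'// X'X''. Qed.

Section IID.
Variables (I : pointedType) (D : set I) (Y : I -> {RV P >-> R}).
Hypothesis indY : mutually_independent D Y.
Hypothesis idY : identically_distributed D Y.

(** Reading an i.i.d. family along any injection gives an i.i.d. family with the
    same marginal, so the law does not depend on the injection. *)
Lemma eq_law_reindex (I' : pointedType) (D' : set I') (phi psi : I' -> I) :
  set_inj D' phi -> (forall i, D' i -> D (phi i)) ->
  set_inj D' psi -> (forall i, D' i -> D (psi i)) ->
  forall A, <<s coord_cylinders D' >> A ->
    P [set t | A (fun i => Y (phi i) t)] = P [set t | A (fun i => Y (psi i) t)].
Proof.
move=> phi_inj phiD psi_inj psiD.
apply: (@eq_law_independent _ _ _ _ _ _ (Y \o phi) (Y \o psi)).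
- exact: mutually_independent_inj phi_inj phiD.
- exact: mutually_independent_inj psi_inj psiD.
- by move=> i D'i A mA; apply: (idY (phiD _ D'i) (psiD _ D'i) mA).
Qed.

(** A measurable functional of the array inherits the invariance of the law of
    the array; both invariances of the periodic sum are instances. *)
Lemma eq_in_dist_reindex (F : nat -> (I -> R) -> R) (phi : I -> I) :
  set_inj D phi -> (forall i, D i -> D (phi i)) ->
  (forall m, measurable_fun [set: g_sigma_algebraType (coord_cylinders D)]
    (F m)) ->
  eq_in_dist P (fun m t => F m (fun i => Y i t))
               (fun m t => F m (fun i => Y (phi i) t)).
Proof.
move=> phi_inj phiD mF A sA.
have id_inj : set_inj D (@id I) by [].
exact: (eq_law_reindex id_inj (fun _ => id) phi_inj phiD
  (measurable_sequence_preimage mF sA)).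
Qed.

End IID.
End EqualLaws.

(** * Almost sure convergence from a moment bound *)

(** Splitting the weight [(r ^+ 2) ^+ k] in two halves: one is spent on bounding
    [u k], the other makes the series geometric. *)
Lemma cvg_series_half_decay (R : realType) (r M : R) (u : R^nat) :
  0 < r < 1 -> (forall k, `|u k| * r ^+ k <= M) ->
  cvgn (series (fun k => (r ^+ 2) ^+ k * u k)).
Proof.
move=> /andP[r0 r1] uM; apply: (@normed_cvg _ R^o).
have M0 : 0 <= M by rewrite (le_trans _ (uM 0%N))// mulr_ge0.
apply: (@series_le_cvg _ _ (geometric M r)) => [k|k|k|].
- exact: normr_ge0.
- by rewrite geometric_ge0// ltW.
- change (`|(r ^+ 2) ^+ k * u k| <= geometric M r k).
  have rk0 : 0 <= r ^+ k by rewrite exprn_ge0// ltW.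
  rewrite normrM -exprM mulnC exprM ger0_norm ?sqr_ge0//= expr2 -mulrA mulrC.
  by rewrite ler_wpM2r// mulrC.
- by apply: is_cvg_geometric_series; rewrite ger0_norm// ltW.
Qed.

Section AlmostSureBound.
Context {d : measure_display} {T : measurableType d} {R : realType}.
Variable P : probability T R.

Lemma markov_moment (X : {RV P >-> R}) (q a : R) : 0 < q -> 0 < a ->
  ('E_P[fun t => (`|X t| `^ q)%R] < +oo)%E ->
  (P [set t | (a <= `|X t|)%R] <=
    ((a `^ q)^-1 * fine 'E_P[fun t => (`|X t| `^ q)%R])%:E)%E.
Proof.
move=> q0 a0 EX.
have aq0 : 0 < a `^ q by exact: powR_gt0.
rewrite EFinM fineK; last first.
  rewrite ge0_fin_numE// unlock; apply: integral_ge0 => t _.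
  by rewrite lee_fin powR_ge0.
rewrite lee_pdivlMl//.
have := @markov _ _ _ P X (fun x => x `^ q) a a0 (measurable_powR q).
apply.
- by move=> x _; exact: powR_ge0.
- exact: ge0_ler_powR (ltW q0).
Qed.

(** Borel-Cantelli: the tail probabilities are summable, so almost surely
    [`|X k t| * r ^+ k] exceeds 1 for finitely many [k] only. *)
Lemma ae_bounded_geometric_tails (X : nat -> T -> R) (r s C : R) :
  (forall k, measurable_fun [set: T] (X k)) ->
  0 < r -> 0 <= s < 1 -> 0 <= C ->
  (forall k, (P [set t | ((r ^+ k)^-1 <= `|X k t|)%R] <= (C * s ^+ k)%:E)%E) ->
  {ae P, forall t, exists M, forall k, `|X k t| * r ^+ k <= M}.
Proof.
move=> mX r0 /andP[s0 s1] C0 XP.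
pose F k := [set t | (r ^+ k)^-1 <= `|X k t|].
have mF k : measurable (F k).
  rewrite (_ : F k = (fun t => `|X k t|) @^-1` `[(r ^+ k)^-1, +oo[); last first.
    by apply/seteqP; split => t /=; rewrite in_itv/= andbT.
  rewrite -[X in measurable X]setTI.
  by apply: (measurableT_comp (@normr_measurable _ setT) (mX k)).
have cs : cvgn (series (geometric C s)).
  by apply: is_cvg_geometric_series; rewrite ger0_norm.
have PF : P (lim_sup_set F) = 0%E.
  apply: lim_sup_set_cvg0 => //.
  apply: (@le_lt_trans _ _ (\sum_(k <oo) (C * s ^+ k)%:E)%E).
    by apply: lee_nneseries => // k _; exact: XP.
  rewrite (_ : (\sum_(k <oo) _)%E = (limn (series (geometric C s)))%:E) ?ltry//.
  rewrite -EFin_lim//; congr (limn _); apply/funext => n /=.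
  by rewrite sumEFin.
exists (lim_sup_set F); split => //.
  by apply: bigcap_measurableType => k _; exact: bigcup_measurable.
move=> t /= nb k _; apply: contrapT => Fk; apply: nb.
have Xr j : (k <= j)%N -> `|X j t| * r ^+ j <= 1.
  move=> kj; rewrite leNgt; apply/negP => Xj; apply: Fk; exists j => //.
  by rewrite /F /= -div1r ler_pdivrMr ?exprn_gt0// ltW.
(* 1 bounds the terms from [k] on, the sum bounds each of the first [k]. *)
exists (1 + \sum_(i < k) `|X i t| * r ^+ i) => j.
have Xge0 i : 0 <= `|X i t| * r ^+ i by rewrite mulr_ge0// exprn_ge0// ltW.
have [kj|jk] := leqP k j.
  by rewrite (le_trans (Xr _ kj))// lerDl sumr_ge0.
by rewrite (bigD1 (Ordinal jk))//= addrCA lerDl addr_ge0// sumr_ge0.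
Qed.

End AlmostSureBound.

(** * Periodic series as functionals of an array of blocks *)

(** The partial sums of the process as a function of a deterministic array; the
    random ones are obtained by evaluating at [fun kn => Y kn.1 kn.2 t]. *)
Definition block_series (R : realType) (p : nat) (b : R) (n : nat)
    (y : nat * nat -> R) : R^nat :=
  series (fun k => b ^+ k * (y (k, n %% p ^ k.+1)%N - y (k, 0 %% p ^ k.+1)%N)).

Definition block_sum (R : realType) (p : nat) (b : R) (n : nat)
    (y : nat * nat -> R) : R :=
  limn (block_series p b n y).

Definition rotate_blocks (p l : nat) (kn : nat * nat) : nat * nat :=
  (kn.1, (kn.2 + l) %% p ^ kn.1.+1)%N.

(** The indices of the array which the process reads along the multiples of
    [u * p ^ v]. *)
Definition dilate_blocks (p v u : nat) (kn : nat * nat) : nat * nat :=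
  (v + kn.1, p ^ v * (u * kn.2 %% p ^ kn.1.+1))%N.

Section BlockIndices.
Variable p : nat.
Hypothesis p_gt0 : (0 < p)%N.

Lemma rotate_blocks_in l kn : block_index p (rotate_blocks p l kn).
Proof. by rewrite /block_index /= ltn_mod expn_gt0 p_gt0. Qed.

Lemma dilate_blocks_in v u kn : block_index p (dilate_blocks p v u kn).
Proof.
rewrite /block_index /= -addnS expnD ltn_pmul2l ?expn_gt0 ?p_gt0//.
by rewrite ltn_mod expn_gt0 p_gt0.
Qed.

Lemma rotate_blocks_inj l : set_inj (block_index p) (rotate_blocks p l).
Proof.
move=> [k i] [k' i'] /set_mem/= ik /set_mem/= ik' [kk']; rewrite -kk' in ik' *.
by move=> /eqP; rewrite eqn_modDr !modn_small// => /eqP ->.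
Qed.

Lemma dilate_blocks_inj v u : coprime p u ->
  set_inj (block_index p) (dilate_blocks p v u).
Proof.
move=> pu [k i] [k' i'] /set_mem/= ik /set_mem/= ik' [] /addnI kk'.
rewrite -kk' in ik' *.
move=> /eqP; rewrite eqn_pmul2l ?expn_gt0 ?p_gt0// => uii'.
congr pair.
(* Divisibility of truncated differences needs the two indices in order. *)
wlog ii' : i i' ik ik' uii' / (i <= i')%N.
  move=> h; have [|/ltnW] := leqP i i'; first exact: h.
  by move=> i'i; apply/esym/h => //; rewrite eq_sym.
move: uii'; rewrite eq_sym eqn_mod_dvd ?leq_mul2l ?ii' ?orbT// -mulnBr.
rewrite Gauss_dvdr ?coprimeXl//.
rewrite -(eqn_mod_dvd _ ii') !modn_small// => /eqP ->//.
Qed.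

End BlockIndices.

Section BlockSeries.
Context {R : realType}.
Variables (p : nat) (b : R).

(** Rotation replaces the reference value [y (k, 0)] by [y (k, l)], hence the
    correction by the [l]-th series. *)
Lemma block_series_rotate l m (y : nat * nat -> R) :
  block_series p b m (y \o rotate_blocks p l) =
  block_series p b (m + l) y \- block_series p b l y.
Proof.
apply/funext => N; rewrite /block_series /series/= -sumrB.
apply: eq_bigr => k _; rewrite /rotate_blocks/= !modnDml add0n -mulrBr.
by congr (_ * _); rewrite opprB addrA subrK.
Qed.

(** The first [v] terms vanish since their period [p ^ k.+1] divides [p ^ v]; in
    the others a factor [p ^ v] comes out of both the index and the period. *)
Lemma block_series_dilate v u m (y : nat * nat -> R) N :
  block_series p b (u * p ^ v * m) y (N + v)%N =
  b ^+ v * block_series p b m (y \o dilate_blocks p v u) N.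
Proof.
rewrite /block_series /series/= (@big_cat_nat _ _ _ v)//= ?leq_addl//.
rewrite big_nat big1 ?add0r; last first.
  move=> k /= kv.
  rewrite (_ : (u * p ^ v * m) %% p ^ k.+1 = 0 %% p ^ k.+1)%N ?subrr ?mulr0//.
  rewrite mod0n; apply/eqP; rewrite -/(dvdn _ _).
  by rewrite dvdn_mulr// dvdn_mull// dvdn_exp2l.
rewrite -{1}[v]add0n big_addn addnK mulr_sumr; apply: eq_bigr => j _.
rewrite /dilate_blocks/= exprD mulrA [b ^+ v * _]mulrC; congr (_ * (y _ - y _)).
  congr pair; first by rewrite addnC.
  by rewrite modnMmr muln_modr -expnD addnS addnC mulnAC mulnC.
by rewrite addnC !mod0n muln0 mod0n muln0.
Qed.

Lemma block_sum_rotate l m (y : nat * nat -> R) :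
  cvgn (block_series p b (m + l) y) -> cvgn (block_series p b l y) ->
  block_sum p b m (y \o rotate_blocks p l) =
  block_sum p b (m + l) y - block_sum p b l y.
Proof. by move=> cml cl; rewrite /block_sum block_series_rotate limB. Qed.

Lemma block_sum_dilate v u m (y : nat * nat -> R) : b != 0 ->
  cvgn (block_series p b (u * p ^ v * m) y) ->
  block_sum p b (u * p ^ v * m) y =
  b ^+ v * block_sum p b m (y \o dilate_blocks p v u).
Proof.
move=> b0 cy; have bv0 : b ^+ v != 0 by rewrite expf_neq0.
rewrite [in RHS]/block_sum.
suff bs : block_series p b m (y \o dilate_blocks p v u) @ \oo -->
    (b ^+ v)^-1 * block_sum p b (u * p ^ v * m) y.
  by rewrite (cvg_lim _ bs)// mulVKf.
have -> : block_series p b m (y \o dilate_blocks p v u) =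
    (fun N => (b ^+ v)^-1 * block_series p b (u * p ^ v * m) y (N + v)%N).
  by apply/funext => N; rewrite block_series_dilate mulKf.
by apply: cvgMl_tmp; rewrite cvg_shiftn.
Qed.

Lemma measurable_block_sum d (S : measurableType d) (y : nat * nat -> S -> R) n :
  (0 < p)%N ->
  (forall kn, block_index p kn -> measurable_fun [set: S] (y kn)) ->
  measurable_fun [set: S] (fun s => block_sum p b n (y ^~ s)).
Proof.
move=> p0 my; apply: measurable_limn => N; apply: measurable_sum => k.
apply: measurable_funM => //; apply: measurable_funB; apply: my;
  by rewrite /block_index/= ltn_mod expn_gt0 p0.
Qed.

End BlockSeries.

(** * The periodic sum of an i.i.d. family *)

Section Model.
Context {d : measure_display} {T : measurableType d} {R : realType}.
Variables (P : probability T R) (p : nat) (b : R).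
Variable Y : nat -> nat -> {RV P >-> R}.
Hypothesis p_prime : prime p.
Hypothesis b01 : 0 < b < 1.
Hypothesis indY : mutually_independent (block_index p) (fun kn => Y kn.1 kn.2).
Hypothesis idY :
  identically_distributed (block_index p) (fun kn => Y kn.1 kn.2).

Let p_gt0 : (0 < p)%N := prime_gt0 p_prime.

(** Two distinct entries of the array are a pair of independent variables with a
    fixed marginal, so the moment assumption on one such pair serves for all. *)
Lemma eq_prob_block_diff k i a : (0 < i < p ^ k.+1)%N ->
  P [set t | a <= `|Y k i t - Y k 0%N t|] =
  P [set t | a <= `|Y 0%N 0%N t - Y 1%N 0%N t|].
Proof.
move=> /andP[i0 ik].
pose D' : set (nat * nat) := [set (0, 0); (1, 0)]%N.
pose phi (x : nat * nat) := (k, if x.1 == 0 then i else 0)%N.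
have phi_inj : set_inj D' phi.
  move=> x y /set_mem[]-> /set_mem[]-> //= [].
    by move=> i00; rewrite i00 in i0.
  by move=> i00; rewrite -i00 in i0.
have phiD x : D' x -> block_index p (phi x).
  by move=> [] -> //=; rewrite /block_index/= expn_gt0 p_gt0.
have idD x : D' x -> block_index p x.
  by move=> [] -> /=; rewrite /block_index/= expn_gt0 p_gt0.
pose A := [set y : nat * nat -> R | a <= `|y (0, 0)%N - y (1, 0)%N|].
apply: (eq_law_reindex indY idY phi_inj phiD (psi := id) _ idD (A := A)) => //.
have my x : D' x ->
    measurable_fun [set: g_sigma_algebraType (coord_cylinders D')]
      (fun y : nat * nat -> R => y x) by exact: measurable_coord.
pose f (y : nat * nat -> R) := `|y (0, 0)%N - y (1, 0)%N|.
rewrite (_ : A = f @^-1` `[a, +oo[); last first.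
  by apply/seteqP; split => y /=; rewrite in_itv/= andbT.
rewrite -[X in _ X]setTI.
have mf := measurableT_comp (@normr_measurable _ setT)
  (measurable_funB (my _ (or_introl erefl)) (my _ (or_intror erefl))).
exact: mf.
Qed.

Hypothesis moment : exists2 q : R, 0 < q &
  ('E_P[fun t => (`|Y 0%N 0%N t - Y 1%N 0%N t| `^ q)%R] < +oo)%E.

Lemma ae_cvg_partial_sums n :
  {ae P, forall t, cvgn (partial_sums p b Y n t)}.
Proof.
have [q q0 Eq] := moment; have [b0 b1] := andP b01.
pose r := Num.sqrt b.
have r0 : 0 < r by rewrite sqrtr_gt0.
have r1 : r < 1 by rewrite -sqrtr1 ltr_sqrt.
pose X k t := Y k (n %% p ^ k.+1)%N t - Y k (0 %% p ^ k.+1)%N t.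
pose C := fine 'E_P[fun t => (`|Y 0%N 0%N t - Y 1%N 0%N t| `^ q)%R].
have C0 : 0 <= C.
  by rewrite fine_ge0// unlock integral_ge0// => t _; rewrite lee_fin powR_ge0.
have : {ae P, forall t, exists M, forall k, `|X k t| * r ^+ k <= M}.
  apply: (@ae_bounded_geometric_tails _ _ _ _ _ _ (r `^ q) C) => //.
  - by move=> k; exact: measurable_funB.
  - have : r `^ q < 1 `^ q.
      by apply: gt0_ltr_powR; rewrite ?nnegrE ?(ltW r0) ?ler01.
    by rewrite powR1 powR_ge0.
  - move=> k; rewrite /X mod0n; have [->|i0] := posnP (n %% p ^ k.+1)%N.
      (* In this case the term of index [k] is identically zero. *)
      rewrite (_ : [set t | _] = set0).
        by rewrite measure0 lee_fin mulr_ge0// exprn_ge0// powR_ge0.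
      apply/seteqP; split => t //=.
      by rewrite subrr normr0 leNgt invr_gt0 exprn_gt0.
    rewrite eq_prob_block_diff ?i0 ?ltn_mod ?expn_gt0 ?p_gt0//.
    have := @markov_moment _ _ _ P (Y 0%N 0%N \- Y 1%N 0%N) q (r ^+ k)^-1 q0 _
      Eq.
    rewrite (_ : C * _ = (((r ^+ k)^-1) `^ q)^-1 * C); last first.
      rewrite -powR_invn ?(ltW r0)// powRAC powR_invn ?powR_ge0// invrK.
      exact: mulrC.
    by apply; rewrite invr_gt0 exprn_gt0.
apply: filterS => t [M XM].
rewrite /partial_sums /periodic_extension -(sqr_sqrtr (ltW b0)).
by apply: cvg_series_half_decay XM; rewrite r0.
Qed.

Lemma measurable_periodic_sum n :
  measurable_fun [set: T] (periodic_sum p b Y n).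
Proof. exact: (@measurable_block_sum _ p b _ _ (fun kn => Y kn.1 kn.2)). Qed.

Lemma measurable_block_sum_cylinders n :
  measurable_fun
    [set: g_sigma_algebraType (@coord_cylinders R _ (block_index p))]
    (block_sum p b n).
Proof.
apply: (@measurable_block_sum _ p b _
  (g_sigma_algebraType (@coord_cylinders R _ (block_index p)))
  (fun kn y => y kn)) => //.
by move=> kn; exact: measurable_coord.
Qed.

Lemma padic_scaling n : (0 < n)%N ->
  padic_norm R p n `^ (- (ln b / ln p%:R)) = b ^+ logn p n.
Proof.
move=> n0; have [b0 b1] := andP b01.
have p1 : 1 < p%:R :> R by rewrite ltr1n prime_gt1.
have pp : 0 < p%:R :> R by exact: lt_trans p1.
rewrite /padic_norm /powR gt_eqF ?invr_gt0 ?exprn_gt0// lnV ?posrE ?exprn_gt0//.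
rewrite lnXn// mulrNN mulrnAr divfK ?gt_eqF ?ln_gt0//.
by rewrite -mulr_natl expRM_natl lnK.
Qed.

Lemma periodic_sum_self_similar n : (0 < n)%N ->
  eq_in_dist P (fun m => periodic_sum p b Y (n * m))
    (fun m t =>
      padic_norm R p n `^ (- (ln b / ln p%:R)) * periodic_sum p b Y m t).
Proof.
move=> n0; have [b0 b1] := andP b01.
have [u pu nE] := pfactor_coprime p_prime n0; set v := logn p n in nE.
pose phi := dilate_blocks p v u.
pose F m y := b ^+ v * block_sum p b m y.
apply: (@eq_in_dist_trans _ _ _ _ _
    (fun m t => F m (fun kn => Y (phi kn).1 (phi kn).2 t))).
  apply: eq_in_dist_ae => m.
  - exact: measurable_periodic_sum.
  - apply: measurable_funM => //.
    exact: (@measurable_block_sum _ p b _ _ (fun kn => Y (phi kn).1 (phi kn).2)).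
  - have := ae_cvg_partial_sums (n * m); apply: filterS => t.
    rewrite [in X in X -> _]nE nE => ct.
    apply: (@block_sum_dilate _ p b v u m (fun kn => Y kn.1 kn.2 t)) => //.
    by rewrite gt_eqF.
move=> A sA; rewrite padic_scaling//.
apply/esym; apply: (eq_in_dist_reindex indY idY (F := F) (phi := phi)) sA.
- exact: dilate_blocks_inj.
- by move=> kn _; exact: dilate_blocks_in.
- move=> m; apply: measurable_funM => //.
  exact: measurable_block_sum_cylinders.
Qed.

Lemma periodic_sum_stationary_increments l :
  eq_in_dist P
    (fun m t => periodic_sum p b Y m.+1 t - periodic_sum p b Y m t)
    (fun m t =>
      periodic_sum p b Y (m + l).+1 t - periodic_sum p b Y (m + l)%N t).
Proof.
pose phi := rotate_blocks p l.
pose F m y : R := block_sum p b m.+1 y - block_sum p b m y.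
apply: (@eq_in_dist_trans _ _ _ _ _
    (fun m t => F m (fun kn => Y (phi kn).1 (phi kn).2 t))).
  apply: (eq_in_dist_reindex indY idY (F := F) (phi := phi)).
  - exact: rotate_blocks_inj.
  - by move=> kn _; exact: rotate_blocks_in.
  - by move=> m; apply: measurable_funB; exact: measurable_block_sum_cylinders.
apply: eq_in_dist_ae => m.
- by apply: measurable_funB;
    exact: (@measurable_block_sum _ p b _ _ (fun kn => Y (phi kn).1 (phi kn).2)).
- by apply: measurable_funB; exact: measurable_periodic_sum.
- have := ae_cvg_partial_sums l.
  have := ae_cvg_partial_sums (m + l).
  have := ae_cvg_partial_sums (m.+1 + l).
  apply: filterS3 => t c1 c2 c3.
  pose y kn := Y kn.1 kn.2 t.
  rewrite /F (@block_sum_rotate _ p b l m.+1 y)//.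
  rewrite (@block_sum_rotate _ p b l m y)//.
  by rewrite opprB addrA subrK.
Qed.

End Model.

Theorem proposition4p2 (d : measure_display) (T : measurableType d)
    (R : realType) (P : probability T R) (p : nat) (b : R)
    (Y : nat -> nat -> {RV P >-> R}) :
  prime p -> 0 < b < 1 ->
  mutually_independent (block_index p) (fun kn => Y kn.1 kn.2) ->
  identically_distributed (block_index p) (fun kn => Y kn.1 kn.2) ->
  nondegenerate_rv (Y 0%N 0%N) ->
  (exists2 q : R, 0 < q &
    ('E_P[fun t => (`|Y 0%N 0%N t - Y 1%N 0%N t| `^ q)%R] < +oo)%E) ->
  (forall n, {ae P, forall t, cvgn (partial_sums p b Y n t)}) /\
  dt_ss_si P (periodic_sum p b Y)
    (fun n => padic_norm R p n `^ (- (ln b / ln p%:R))).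
Proof.
move=> p_prime b01 indY idY _ moment; split.
  exact: ae_cvg_partial_sums.
split.
- by move=> m; apply: measurable_periodic_sum.
- by move=> n n0; rewrite padic_scaling// exprn_gt0//; case/andP: b01.
- exact: periodic_sum_self_similar.
- by move=> k _; exact: periodic_sum_stationary_increments.
Qed.
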